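(* Let $k\ge 1$ be an integer and let $X_1,\ldots,X_k$ be independent random variables, each distributed as follows: $X_i$ has the distribution of a random variable $X$ such that, for a random variable $U$ uniformly distributed on $(0,1)$, conditionally on $U=u$ the variable $X$ is gamma distributed with shape $u$ and rate $1$ (conditional density $\frac{e^{-x}x^{u-1}}{\Gamma(u)}$ for $x\ge 0$). Then for every integer $n\ge 0$, \[ E\big[(X_1+\cdots+X_k)^n\big]=(-1)^n B_n^{(n-k+1)}(-k+1). \]
   Context: For any integer $r$ (possibly zero or negative), the Bernoulli polynomials of order $r$ are defined by $\left(\frac{t}{e^t-1}\right)^r e^{xt}=\sum_{n=0}^\infty B_n^{(r)}(x)\frac{t^n}{n!}$. *)

(* Defs.v *)
From HB Require Import structures.
From mathcomp Require Import all_boot all_order all_algebra.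
From mathcomp Require Import all_classical all_reals all_analysis.

Set Implicit Arguments.
Unset Strict Implicit.
Unset Printing Implicit Defensive.

Import Order.TTheory GRing.Theory Num.Theory.
Import numFieldNormedType.Exports.

Local Open Scope classical_set_scope.
Local Open Scope ring_scope.

(* A formal power series is encoded by its coefficients: [f : nat -> F] stands
   for \sum_n f n * t ^ n. *)
Section FormalPowerSeries.
Context {F : fieldType}.
Implicit Types f g : nat -> F.

Definition fps_one : nat -> F := fun n => (n == 0)%N%:R.

Definition fps_mul f g : nat -> F := fun n => \sum_(i < n.+1) f i * g (n - i)%N.

Fixpoint fps_inv_coefs f (n : nat) : seq F :=
  if n is m.+1 then
    let s := fps_inv_coefs f m in
    rcons s ((f 0)^-1 * ((m == 0)%N%:R - \sum_(i < m) s`_i * f (m - i)%N))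
  else [::].

(* Meaningful only when [f 0 != 0], see [fps_mulVf]. *)
Definition fps_inv f : nat -> F := fun n => (fps_inv_coefs f n.+1)`_n.

Definition fps_pow f (m : nat) : nat -> F := iter m (fps_mul f) fps_one.

Definition fps_powz f (r : int) : nat -> F :=
  match r with
  | Posz m => fps_pow f m
  | Negz m => fps_pow (fps_inv f) m.+1
  end.

(* e ^ (x t) *)
Definition fps_exp (x : F) : nat -> F := fun n => x ^+ n / n`!%:R.

(* (e ^ t - 1) / t: drop the constant term of e ^ t and shift. *)
Definition fps_expm1_div_t : nat -> F := fun n => fps_exp 1 n.+1.

Lemma size_fps_inv_coefs f n : size (fps_inv_coefs f n) = n.
Proof. by elim: n => //= n IH; rewrite size_rcons IH. Qed.

Lemma nth_fps_inv_coefs f n i : (i < n)%N -> (fps_inv_coefs f n)`_i = fps_inv f i.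
Proof.
elim: n => // n IH; rewrite ltnS leq_eqVlt => /orP[/eqP->//|lt_in].
by rewrite -IH//= nth_rcons size_fps_inv_coefs lt_in.
Qed.

Lemma fps_mulVf f : f 0 != 0 -> fps_mul (fps_inv f) f = fps_one.
Proof.
move=> f0; apply/funext => n; rewrite /fps_mul big_ord_recr/= subnn.
rewrite [fps_inv f n]/fps_inv/= nth_rcons size_fps_inv_coefs ltnn eqxx.
under [X in _ - X]eq_bigr do rewrite nth_fps_inv_coefs//.
by rewrite mulrAC mulVf// mul1r addrC subrK.
Qed.

Lemma fps_expm1_div_t0 : fps_expm1_div_t 0 != 0.
Proof. by rewrite /fps_expm1_div_t /fps_exp expr1n divr1 oner_neq0. Qed.

End FormalPowerSeries.

(* B_n^{(r)}(x) = n! [t^n] (t / (e ^ t - 1)) ^ r e ^ (x t). *)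
Definition bernoulli_poly {F : numFieldType} (r : int) (n : nat) (x : F) : F :=
  n`!%:R * fps_mul (fps_powz (fps_inv fps_expm1_div_t) r) (fps_exp x) n.

Section Probability.
Context {R : realType}.
Local Notation leb := (@lebesgue_measure R).

(* For [0 < u] only: the integral diverges for [u <= 0] and the real-valued
   integral is then [0]. *)
Definition Gamma (u : R) : R :=
  \int[leb]_(x in `[0, +oo[) (expR (- x) * x `^ (u - 1)).

(* Density of the gamma distribution of shape u and rate 1. *)
Definition gamma_pdf (u x : R) : R :=
  if 0 <= x then expR (- x) * x `^ (u - 1) / Gamma u else 0.

Context {d : measure_display} {T : measurableType d} (P : probability T R).

(* Conditionally on U = u, X has density [f u] w.r.t. the Lebesgue measure:
   the joint law of (U, X) is (law of U)(du) f u x dx. *)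
Definition has_conditional_density (U X : {RV P >-> R}) (f : R -> R -> R) :=
  forall A B : set R, measurable A -> measurable B ->
    P (U @^-1` A `&` X @^-1` B) =
    (\int[distribution P U]_(u in A) \int[leb]_(x in B) (f u x)%:E)%E.

(* Mutual independence: product rule over every subfamily. *)
Definition independent_RVs (I : finType) (X : I -> {RV P >-> R}) :=
  forall (J : {set I}) (A : I -> set R), (forall i, measurable (A i)) ->
    P (\bigcap_(i in [set` J]) (X i @^-1` A i)) =
    (\prod_(i in J) P (X i @^-1` A i))%E.

End Probability.

Arguments has_conditional_density {R d T} P U X f.
Arguments independent_RVs {R d T} P {I} X.

(* Main.v *)
Require Import Defs.
From HB Require Import structures.
From mathcomp Require Import all_boot all_order all_algebra.
From mathcomp Require Import all_classical all_reals all_analysis.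
From mathcomp Require Import measurable_realfun ring.

Set Implicit Arguments.
Unset Strict Implicit.
Unset Printing Implicit Defensive.

Import Order.TTheory GRing.Theory Num.Theory.
Import numFieldNormedType.Exports.

Local Open Scope classical_set_scope.
Local Open Scope ring_scope.

(* The n-th moment of a gamma variable of shape u is the rising factorial
   (u)_n = u (u + 1) ... (u + n - 1), so X has moments m_n = \int_0^1 (u)_n du,
   and by independence the moments of X_1 + ... + X_k are the coefficients of
   the k-th power of the exponential generating function mu of (m_n).

   Let R_x be the exponential generating function of ((x)_n), so that
   R_x R_u = R_(x + u), and let h = t / (e^t - 1).  The equation
   t h' = h - h^2 - t h gives (x)_n = (-1)^n B_n^(n+1)(1 - x).  Integrating
   over a unit interval lowers the order of a Bernoulli polynomial by one, so
   by induction on k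
     n! [t^n] (mu^k R_x) = (-1)^n B_n^(n+1-k)(1 - k - x);
   the theorem is the case x = 0, where R_0 = 1. *)

(** * Formal power series *)

Section FpsRing.
Context {F : fieldType}.

(* An alias, so that the convolution product does not clash with the pointwise
   ring structure on functions. *)
Definition fps : Type := nat -> F.

HB.instance Definition _ := Choice.copy fps (nat -> F).

Implicit Types f g h : fps.

Definition fps_zero : fps := fun=> 0.
Definition fps_opp f : fps := fun n => - f n.
Definition fps_add f g : fps := fun n => f n + g n.

Fact fps_addA : associative fps_add.
Proof. by move=> f g h; apply/funext => n; rewrite /fps_add addrA. Qed.

Fact fps_addC : commutative fps_add.
Proof. by move=> f g; apply/funext => n; rewrite /fps_add addrC. Qed.

Fact fps_add0 : left_id fps_zero fps_add.
Proof. by move=> f; apply/funext => n; rewrite /fps_add add0r. Qed.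

Fact fps_addN : left_inverse fps_zero fps_opp fps_add.
Proof. by move=> f; apply/funext => n; rewrite /fps_add addNr. Qed.

HB.instance Definition _ :=
  GRing.isZmodule.Build fps fps_addA fps_addC fps_add0 fps_addN.

Let trunc n f : {poly F} := \poly_(i < n) f i.

(** Coefficient [n] of a convolution only sees coefficients up to [n], so associativity and
    commutativity can be inherited from polynomials by truncation. *)
Let fps_mul_trunc N f g n : (n < N)%N ->
  fps_mul f g n = (trunc N f * trunc N g)`_n.
Proof.
move=> nN; rewrite coefM; apply: eq_bigr => -[i /=]; rewrite ltnS => ni _.
by rewrite !coef_poly (leq_ltn_trans ni nN) (leq_ltn_trans (leq_subr _ _) nN).
Qed.

Fact fps_mulA : associative (@fps_mul F).
Proof.
move=> f g h; apply/funext => n.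
transitivity ((trunc n.+1 f * (trunc n.+1 g * trunc n.+1 h))`_n).
  rewrite coefM; apply: eq_bigr => i _.
  by rewrite coef_poly ltn_ord (@fps_mul_trunc n.+1)// ltnS leq_subr.
rewrite mulrA coefM; apply: eq_bigr => i _.
by rewrite [in RHS](@fps_mul_trunc n.+1)// coef_poly ltnS leq_subr.
Qed.

Fact fps_mulC : commutative (@fps_mul F).
Proof.
by move=> f g; apply/funext => n; rewrite !(@fps_mul_trunc n.+1)// mulrC.
Qed.

Fact fps_mul1 : left_id (@fps_one F) (@fps_mul F).
Proof.
move=> f; apply/funext => n; rewrite /fps_mul big_ord_recl big1 /=.
  by rewrite mul1r subn0 addr0.
by move=> i _; rewrite mul0r.
Qed.

Fact fps_mulDl : left_distributive (@fps_mul F) fps_add.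
Proof.
move=> f g h; apply/funext => n; rewrite /fps_add /fps_mul -big_split/=.
by apply: eq_bigr => i _; rewrite mulrDl.
Qed.

Fact fps_one_neq0 : (@fps_one F : fps) != 0.
Proof. by apply/eqP => /(congr1 (@^~ 0%N)) /eqP; rewrite oner_eq0. Qed.

HB.instance Definition _ := GRing.Zmodule_isComNzRing.Build fps
  fps_mulA fps_mulC fps_mul1 fps_mulDl fps_one_neq0.

Lemma fpsD f g n : (f + g) n = f n + g n. Proof. by []. Qed.
Lemma fpsN f n : (- f) n = - f n. Proof. by []. Qed.
Lemma fpsM f g n : (f * g) n = \sum_(i < n.+1) f i * g (n - i)%N.
Proof. by []. Qed.
Lemma fps1 n : (1 : fps) n = (n == 0)%N%:R. Proof. by []. Qed.

Lemma fps_natmul f m n : (m%:R * f) n = m%:R * f n.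
Proof.
rewrite !mulr_natl; elim: m => [|m IH]; first by rewrite !mulr0n.
by rewrite !mulrS fpsD IH.
Qed.

Definition fpsC (a : F) : fps := fun n => if n is 0 then a else 0.
Definition fpsX : fps := fun n => (n == 1)%N%:R.

Lemma fpsCM a f n : (fpsC a * f) n = a * f n.
Proof.
rewrite fpsM big_ord_recl big1 /=; first by rewrite subn0 addr0.
by move=> i _; rewrite mul0r.
Qed.

Lemma fpsXM0 f : (fpsX * f) 0%N = 0.
Proof. by rewrite fpsM big_ord1 mul0r. Qed.

Lemma fpsXMS f n : (fpsX * f) n.+1 = f n.
Proof.
rewrite fpsM !big_ord_recl big1 /=; first
  by rewrite mul0r mul1r add0r addr0 /bump /= subSS subn0.
by move=> i _; rewrite mul0r.
Qed.

(* The Euler operator [t * d/dt]. *)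
Definition fps_euler f : fps := fun n => n%:R * f n.

Lemma fps_euler1 : fps_euler 1 = 0.
Proof. by apply/funext => -[|n]; rewrite /fps_euler ?mul0r// mulr0. Qed.

Lemma fps_eulerM f g : fps_euler (f * g) = fps_euler f * g + f * fps_euler g.
Proof.
apply/funext => n; rewrite fpsD /fps_euler !fpsM mulr_sumr -big_split/=.
apply: eq_bigr => -[i /=]; rewrite ltnS => ni _.
have -> : n%:R = i%:R + (n - i)%:R :> F by rewrite -natrD subnKC.
by rewrite /fps_euler; ring.
Qed.

Lemma fps_eulerX f n :
  fps_euler (f ^+ n.+1) = n.+1%:R * f ^+ n * fps_euler f.
Proof.
elim: n => [|n IH]; first by rewrite expr1 expr0 !mul1r.
by rewrite exprS fps_eulerM IH -[in RHS]natr1 !exprS; ring.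
Qed.

Lemma fps_powE f n : fps_pow f n = f ^+ n.
Proof. by elim: n => // n IH; rewrite exprS -IH. Qed.

End FpsRing.
Arguments fps : clear implicits.

(** * Bernoulli polynomials and rising factorials *)

Section Bernoulli.
Context {F : numFieldType}.

Let fact_neq0 n : n`!%:R != 0 :> F. Proof. by rewrite pnatr_eq0 -lt0n fact_gt0. Qed.

Local Notation E x := (fps_exp x : fps F).
Local Notation A := (@fps_expm1_div_t F : fps F).
Local Notation h := (fps_inv A : fps F).

Lemma fps_expD (x y : F) : E (x + y) = E x * E y.
Proof.
apply/funext => n; rewrite fpsM {1}/fps_exp addrC exprDn mulr_suml.
apply: eq_bigr => -[i /=]; rewrite ltnS => ni _; rewrite /fps_exp.
rewrite -(bin_fact ni) !natrM -mulr_natr.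
have Cn0 : 'C(n, i)%:R != 0 :> F by rewrite pnatr_eq0 -lt0n bin_gt0.
by field; rewrite Cn0 !fact_neq0.
Qed.

Lemma fps_euler_exp (x : F) : fps_euler (E x) = fpsC x * (fpsX * E x).
Proof.
apply/funext => -[|n]; rewrite fpsCM ?fpsXM0 ?fpsXMS /fps_euler ?mul0r ?mulr0//.
rewrite /fps_exp factS natrM exprS; field.
by rewrite fact_neq0 addrC natr1 pnatr_eq0.
Qed.

Lemma fpsX_expm1_div_t : fpsX * A = E 1 - 1.
Proof.
apply/funext => -[|n]; rewrite ?fpsXM0 ?fpsXMS fpsD fpsN fps1.
  by rewrite /fps_exp expr0 divr1 subrr.
by rewrite subr0.
Qed.

(** Coefficientwise this is [n / (n + 1)! = 1 / n! - 1 / (n + 1)!]. *)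
Lemma fps_euler_expm1_div_t : fps_euler A = E 1 - A.
Proof.
apply/funext => n; rewrite fpsD fpsN /fps_euler.
rewrite /fps_expm1_div_t /fps_exp !expr1n factS natrM; field.
by rewrite fact_neq0 addrC natr1 pnatr_eq0.
Qed.

Lemma fps_bernM : h * A = 1.
Proof. exact: fps_mulVf fps_expm1_div_t0. Qed.

(** Negative powers in [fps_powz] are built from [fps_inv h]; by uniqueness of inverses they are
    powers of [A]. *)
Lemma fps_inv_bern : (fps_inv h : fps F) = A.
Proof.
have h0 : h 0%N != 0.
  apply/eqP => h0; have /(congr1 (@^~ 0%N)) := fps_bernM.
  by rewrite fpsM big_ord1 h0 mul0r fps1 => /eqP; rewrite eq_sym oner_eq0.
have hV : (fps_inv h : fps F) * h = 1 by exact: fps_mulVf h0.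
by rewrite -[RHS](mul1r (A : fps F)) -hV -mulrA fps_bernM mulr1.
Qed.

Lemma fps_euler_bern : fps_euler h = h - h ^+ 2 - fpsX * h.
Proof.
have /(congr1 fps_euler) := fps_bernM.
rewrite fps_eulerM fps_euler1 fps_euler_expm1_div_t.
have -> : E 1 = fpsX * A + 1 by rewrite fpsX_expm1_div_t subrK.
move=> e.
(* Arranged so that the first product vanishes by [e], while [h A = 1] kills the second one and
   reduces the third to [h t]. *)
transitivity (h * (fps_euler h * A + h * (fpsX * A + 1 - A))
    + (fps_euler h - h) * (1 - h * A) - h * (h * A) * fpsX - h ^+ 2 + h).
  by ring.
by rewrite e fps_bernM; ring.
Qed.

Local Notation H r := (fps_powz h r : fps F).

(** For [r > 0] a factor [h] cancels; otherwise one more factor [A] is collected. Nonpositive orders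
    matter because [n + 1 - k] is negative once [k > n + 1]. *)
Lemma fps_powz_bernM (r : int) : H r * A = H (r - 1).
Proof.
have Hnat n : H n%:Z = h ^+ n by exact: fps_powE.
have Hneg n : H (Negz n) = A ^+ n.+1 by rewrite /= fps_inv_bern -fps_powE.
case: r => [[|n]|n].
- by rewrite Hnat expr0 mul1r sub0r (Hneg 0%N) expr1.
- have -> : n.+1%:Z - 1 = n by rewrite intS addrC addKr.
  by rewrite !Hnat exprSr -mulrA fps_bernM mulr1.
- have -> : Negz n - 1 = Negz n.+1
    by rewrite !NegzE -opprD; congr (- _); rewrite [RHS]intS addrC.
  by rewrite !Hneg -exprSr.
Qed.

Definition rising (x : F) (n : nat) : F := \prod_(i < n) (x + i%:R).

(* The coefficient of [t ^ n.+1] in the identity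
   [t (h ^ n.+1 e^(xt))' = n.+1 h ^ n.+1 e^(xt) - n.+1 h ^ n.+2 e^(xt)
      + (x - n.+1) t h ^ n.+1 e^(xt)]. *)
Lemma fps_bernX_exp_rec n (x : F) :
  n.+1%:R * (h ^+ n.+2 * E x) n.+1 = (x - n.+1%:R) * (h ^+ n.+1 * E x) n.
Proof.
have /(congr1 (@^~ n.+1)) : fps_euler (h ^+ n.+1 * E x)
    + n.+1%:R * (h ^+ n.+2 * E x) =
    n.+1%:R * (h ^+ n.+1 * E x) + (fpsC x * (fpsX * (h ^+ n.+1 * E x))
      - n.+1%:R * (fpsX * (h ^+ n.+1 * E x))).
  rewrite fps_eulerM fps_eulerX fps_euler_exp fps_euler_bern !exprS; ring.
rewrite !fpsD fpsN !fps_natmul fpsCM !fpsXMS /fps_euler => /addrI ->.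
by rewrite mulrBl.
Qed.

(** Induction on [n]: the factor [x - (n + 1) = - ((1 - x) + n)] of the recurrence is, up to sign,
    the next factor of the rising factorial. *)
Lemma fps_bernX_exp_rising n (x : F) :
  (h ^+ n.+1 * E x) n = (-1) ^+ n * rising (1 - x) n / n`!%:R.
Proof.
elim: n => [|n IH].
  rewrite /rising big_ord0 fpsM big_ord1 expr1 /fps_exp !expr0 !divr1 !mul1r mulr1.
  by have /(congr1 (@^~ 0%N)) := fps_bernM; rewrite fpsM big_ord1 fps1
    /fps_expm1_div_t /fps_exp expr1n divr1 mulr1.
have n0 : n.+1%:R != 0 :> F by rewrite pnatr_eq0.
apply: (mulfI n0); rewrite fps_bernX_exp_rec IH /rising big_ord_recr/=.
rewrite factS natrM exprS -natr1 in n0 *; field.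
by rewrite fact_neq0 n0.
Qed.

(** The binomial series [(1 - t)^(-x)], written [R_x] in the overview. *)
Definition fps_rising (x : F) : fps F := fun n => rising x n / n`!%:R.

Lemma fps_rising0 : fps_rising 0 = 1.
Proof.
apply/funext => -[|n]; rewrite /fps_rising /rising fps1 ?big_ord0 ?divr1//.
by rewrite big_ord_recl add0r !mul0r.
Qed.

(** The differential equation [(1 - t) f' = x f] of [(1 - t)^(-x)], multiplied by [t]. *)
Lemma fps_euler_rising (x : F) : fps_euler (fps_rising x) =
  fpsX * fps_euler (fps_rising x) + fpsC x * (fpsX * fps_rising x).
Proof.
apply/funext => -[|n]; rewrite fpsD fpsCM ?fpsXM0 ?fpsXMS /fps_euler.
  by rewrite mul0r mulr0 addr0.
have n0 : n.+1%:R != 0 :> F by rewrite pnatr_eq0.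
rewrite /fps_rising /rising big_ord_recr/= factS natrM -natr1 in n0 *; field.
by rewrite fact_neq0 n0.
Qed.

(** The coefficient of [t^(n+1)] reads [(n + 1) f_(n+1) = (n + x) f_n], so the constant term
    determines the series. *)
Lemma fps_euler_rising_uniq (x : F) (f : fps F) : f 0%N = 1 ->
  fps_euler f = fpsX * fps_euler f + fpsC x * (fpsX * f) -> f = fps_rising x.
Proof.
move=> f0 ef; apply/funext; elim=> [|n IH].
  by rewrite f0 /fps_rising /rising big_ord0 divr1.
have n0 : n.+1%:R != 0 :> F by rewrite pnatr_eq0.
apply: (mulfI n0).
have := congr1 (@^~ n.+1) ef; have := congr1 (@^~ n.+1) (fps_euler_rising x).
by rewrite !fpsD !fpsCM !fpsXMS /fps_euler IH => -> ->.
Qed.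

(** The Chu-Vandermonde identity in series form: by the Leibniz rule the product solves the equation
    with parameter [x + y]. *)
Lemma fps_risingD (x y : F) : fps_rising (x + y) = fps_rising x * fps_rising y.
Proof.
apply/esym/fps_euler_rising_uniq.
  by rewrite fpsM big_ord1 /fps_rising /rising !big_ord0 !divr1 mulr1.
have CD : fpsC (x + y) = fpsC x + fpsC y.
  by apply/funext => -[|n]; rewrite fpsD//= addr0.
rewrite fps_eulerM CD [in LHS](fps_euler_rising x) [in LHS](fps_euler_rising y).
by ring.
Qed.

End Bernoulli.

(** * Means over the unit interval and powers of the moment series *)

Section UnitMean.
Context {R : realType}.
Local Notation leb := (@lebesgue_measure R).
Local Notation h := (fps_inv fps_expm1_div_t : fps R).
Local Notation E x := (fps_exp x : fps R).
Local Notation H r := (fps_powz h r : fps R).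

Definition unit_mean (f : R -> R) : R := \int[leb]_(u in `[0, 1]) f u.

Lemma unit_mean_integrable (f : R -> R) : continuous f ->
  leb.-integrable `[0, 1] (EFin \o f).
Proof.
move=> cf; apply: continuous_compact_integrable; first exact: segment_compact.
exact: continuous_subspaceT.
Qed.

Lemma unit_meanZ (f : R -> R) c : continuous f ->
  unit_mean (fun u => c * f u) = c * unit_mean f.
Proof.
by move=> cf; rewrite /unit_mean RintegralZl//; exact: unit_mean_integrable.
Qed.

Lemma continuous_sum_fun (I : Type) (s : seq I) (f : I -> R -> R) :
  (forall i, continuous (f i)) -> continuous (fun u => \sum_(i <- s) f i u).
Proof.
by move=> cf u; apply: cvg_big => [|i _]; [exact: add_continuous|exact: cf].
Qed.

Lemma unit_mean_sum (I : Type) (s : seq I) (f : I -> R -> R) :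
  (forall i, continuous (f i)) ->
  unit_mean (fun u => \sum_(i <- s) f i u) = \sum_(i <- s) unit_mean (f i).
Proof.
move=> cf; elim: s => [|i s IH].
  rewrite big_nil; under [X in unit_mean X]funext do rewrite big_nil.
  by rewrite /unit_mean Rintegral_cst//= mul0r.
rewrite big_cons -IH; under [X in unit_mean X]funext do rewrite big_cons.
rewrite /unit_mean RintegralD//; apply: unit_mean_integrable => //.
exact: continuous_sum_fun.
Qed.

Lemma continuous_fps_exp_sub (y : R) n :
  continuous (fun u => fps_exp (y - u) n).
Proof.
move=> u; rewrite /fps_exp; apply: cvgM; last exact: cvg_cst.
apply: (@continuous_comp _ _ _ (fun v => y - v) (fun v => v ^+ n)).
  by apply: cvgB => //; exact: cvg_cst.
exact: exprn_continuous.
Qed.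

(** Fundamental theorem of calculus with antiderivative [- (y - u)^(n+1) / (n+1)!] in [u]. In series
    form, the mean of [e^((y-u)t)] is [(e^(yt) - e^((y-1)t)) / t]. *)
Lemma unit_mean_fps_exp (y : R) n :
  unit_mean (fun u => fps_exp (y - u) n) = fps_exp y n.+1 - fps_exp (y - 1) n.+1.
Proof.
pose F u : R := - fps_exp (y - u) n.+1.
have dF u : is_derive u (1 : R) F (fps_exp (y - u) n).
  have -> : F = - ((n.+1)`!%:R^-1 *: (cst y - id) ^+ n.+1).
    by apply/funext => v; rewrite /F /fps_exp !fctE mulrC.
  apply: is_derive_eq; rewrite /fps_exp /= factS natrM.
  rewrite !fctE /GRing.scale/=; field.
  by rewrite addrC natr1 !pnatr_eq0 -lt0n fact_gt0.
have cF : continuous F.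
  by move=> u; apply: differentiable_continuous; exact/derivable1_diffP.
rewrite /unit_mean /Rintegral (@continuous_FTC2 _ _ F)//=.
- by rewrite /F subr0 opprK addrC.
- exact/continuous_subspaceT/continuous_fps_exp_sub.
- split=> [v _||]; first by [].
  + by apply: cvg_at_right_filter; exact: cF.
  + by apply: cvg_at_left_filter; exact: cF.
- by move=> v _; rewrite derive1E derive_val.
Qed.

Lemma continuous_rising n : continuous (fun u : R => rising u n).
Proof.
move=> u; apply: cvg_big => [|i _]; first exact: mul_continuous.
by apply: cvgD => //; exact: cvg_cst.
Qed.

(** The series [mu] of the overview; its coefficient [n] is the moment [m_n] already divided by
    [n!]. *)
Definition rising_moment : fps R :=
  fun n => unit_mean (fun u => fps_rising u n).

(** The induction on [k] needs every [x]: one factor [mu] is the mean of [R_u] over [u], and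
    [R_u R_x = R_(u + x)] turns it into a shift of [x]. *)
Lemma rising_momentX k n (x : R) :
  (rising_moment ^+ k * fps_rising x) n =
  (-1) ^+ n * (H (n%:Z + 1 - k%:Z) * E (1 - k%:R - x)) n.
Proof.
have cfR m : continuous (fun u : R => fps_rising u m).
  by move=> u; apply: cvgM; [exact: continuous_rising|exact: cvg_cst].
elim: k n x => [|k IH] n x.
  have -> : n%:Z + 1 - 0%:Z = n.+1 by rewrite subr0 intS addrC.
  have -> : H n.+1 = (h : fps R) ^+ n.+1 by rewrite -fps_powE.
  rewrite expr0 mul1r subr0 fps_bernX_exp_rising.
  rewrite !mulrA -exprD addnn -mul2n exprM sqrrN !expr1n mul1r opprB.
  by rewrite addrCA subrr addr0.
transitivity (unit_mean (fun u => (rising_moment ^+ k * fps_rising (u + x)) n)).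
  under [X in unit_mean X]funext do
    rewrite fps_risingD mulrCA fpsM.
  rewrite exprSr -mulrA mulrCA fpsM unit_mean_sum; last first.
    by move=> i u; apply: cvgM; [exact: cfR|exact: cvg_cst].
  apply: eq_bigr => i _; rewrite [LHS]mulrC -unit_meanZ//.
  by congr unit_mean; apply/funext => u; rewrite mulrC.
under [X in unit_mean X]funext do rewrite IH.
set y := 1 - k%:R - x; set r := n%:Z + 1 - k%:Z.
have yu u : 1 - k%:R - (u + x) = y - u by rewrite /y; ring.
under [X in unit_mean X]funext do rewrite yu fpsM mulr_sumr.
have cE m : continuous (fun u => fps_exp (y - u) m).
  exact: continuous_fps_exp_sub.
rewrite unit_mean_sum; last first.
  by move=> i u; do 2 (apply: cvgM; first exact: cvg_cst); exact: cE.
have -> : n%:Z + 1 - k.+1%:Z = r - 1 by rewrite /r intS; ring.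
have -> : 1 - k.+1%:R - x = y - 1 by rewrite /y -natr1; ring.
(* The difference [E y - E (y - 1)] is [E (y - 1)] times [e^t - 1 = t A], and [A] lowers the order.
   Keeping the factor [t] on the left avoids dividing by it. *)
have e : fpsX * (H (r - 1) * E (y - 1)) = H r * (E y - E (y - 1)).
  have -> : E y = E 1 * E (y - 1) by rewrite -fps_expD; congr (fps_exp _); ring.
  rewrite -fps_powz_bernM.
  transitivity (H r * (E (y - 1) * (fpsX * @fps_expm1_div_t R))); first ring.
  by rewrite fpsX_expm1_div_t; ring.
have -> : (H (r - 1) * E (y - 1)) n = (H r * (E y - E (y - 1))) n.+1.
  by rewrite -e fpsXMS.
have E0 z : E z 0%N = 1 by rewrite /fps_exp expr0 divr1.
(* Coefficient [n + 1] has one summand more than the left side; it vanishes because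
   [E y - E (y - 1)] has constant term 0. *)
rewrite [in RHS]fpsM [in RHS]big_ord_recr/= subnn fpsD fpsN !E0 subrr mulr0 addr0.
rewrite mulr_sumr; apply: eq_bigr => i _; rewrite unit_meanZ; last first.
  by move=> u; apply: cvgM; [exact: cvg_cst|exact: cE].
rewrite (unit_meanZ _ (cE _)) unit_mean_fps_exp fpsD fpsN subSn//.
by rewrite -ltnS.
Qed.

End UnitMean.

Lemma rising_moment_bernoulli (R : realType) (k n : nat) :
  n`!%:R * (@rising_moment R ^+ k) n =
  (-1) ^+ n * bernoulli_poly (n%:Z - k%:Z + 1) n (- k%:R + 1 : R).
Proof.
have := rising_momentX k n (0 : R); rewrite fps_rising0 mulr1 => ->.
by rewrite mulrCA subr0 addrAC [1 - _]addrC.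
Qed.

(** * Integration against an image measure with a density *)

Section Transfer.
Context d1 d2 (T1 : measurableType d1) (T2 : measurableType d2) (R : realType).
Context (mu : {measure set T1 -> \bar R}) (nu : {measure set T2 -> \bar R}).
Context (w : T1 -> R) (Y : T1 -> T2).
Local Open Scope ereal_scope.
Context (mw : measurable_fun [set: T1] w) (w0 : forall x, (0 <= w x)%R).
Context (mY : measurable_fun [set: _] Y).
Context (wnu : forall B, measurable B ->
  \int[mu]_(x in Y @^-1` B) (w x)%:E = nu B).

Import HBNNSimple.

Let mYV B : measurable B -> measurable (Y @^-1` B).
Proof. by move=> mB; rewrite -[_ @^-1` _]setTI; exact: mY. Qed.

Let transfer_nnsfun (g : {nnsfun T2 >-> R}) :
  \int[mu]_x ((w x)%:E * (g (Y x))%:E) = \int[nu]_y (g y)%:E.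
Proof.
have gr0 r : range g r -> (0 <= r)%R by move=> [t _ <-].
under [RHS]eq_integral do rewrite fimfunE -fsumEFin//.
rewrite [RHS]ge0_integral_fsum//; last 2 first.
  - by move=> r; exact/measurable_EFinP/measurableT_comp.
  - by move=> n x _; rewrite EFinM nnfun_muleindic_ge0.
under [LHS]eq_integral.
  move=> x _; rewrite fimfunE -fsumEFin// ge0_mule_fsumr; last first.
    by move=> r; rewrite EFinM nnfun_muleindic_ge0.
  over.
have mwr r : measurable_fun [set: _]
    (fun x => (w x)%:E * (r * \1_(g @^-1` [set r]) (Y x))%:E).
  apply: emeasurable_funM; first exact/measurable_EFinP.
  apply/measurable_EFinP.
  apply: measurable_funM => //.
  by apply: measurableT_comp => //; exact: measurable_indic.
rewrite [LHS]ge0_integral_fsum//; last first.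
  by move=> r x _; rewrite mule_ge0//; [rewrite lee_fin|
    rewrite EFinM nnfun_muleindic_ge0].
apply: eq_fsbigr => r /set_mem/gr0 r0.
under [RHS]eq_integral do rewrite EFinM.
rewrite ge0_integralZl//; last first.
  exact/measurable_EFinP/measurable_indic.
rewrite integral_indic// setIT -wnu//.
rewrite [in RHS]integral_mkcond -ge0_integralZl//; last 2 first.
- apply/(measurable_restrictT _ _).1; first exact: mYV.
  exact/measurable_funTS/measurable_EFinP.
- by move=> x _; apply: erestrict_ge0 => z _; rewrite lee_fin.
apply: eq_integral => x _; rewrite patchE indicE EFinM muleCA.
have -> : (Y x \in g @^-1` [set r]) = (x \in Y @^-1` (g @^-1` [set r])).
  by apply/idP/idP; rewrite !inE.
by case: ifP => _; rewrite ?mule1 ?mule0.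
Qed.

(** Hypothesis [wnu] says that [nu] is the image under [Y] of the measure with density [w]. It
    extends from indicators to simple functions by linearity, then to [g] by monotone
    convergence. *)
Lemma ge0_integral_density (g : T2 -> \bar R) :
  measurable_fun [set: _] g -> (forall y, 0 <= g y) ->
  \int[mu]_x ((w x)%:E * g (Y x)) = \int[nu]_y g y.
Proof.
move=> mg g0.
pose f := nnsfun_approx measurableT mg.
transitivity (limn (fun n => \int[mu]_x ((w x)%:E * (f n (Y x))%:E))).
  rewrite -monotone_convergence//=.
  - apply: eq_integral => x _; apply/esym/cvg_lim => //=.
    by apply: cvgeZl => //; exact: cvg_nnsfun_approx.
  - move=> n; apply: emeasurable_funM; first exact/measurable_EFinP.
    apply/measurable_EFinP.
    by apply: measurableT_comp.
  - by move=> n x _; rewrite mule_ge0 ?lee_fin// lee_fin.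
  - move=> x _ m n mn; rewrite lee_wpmul2l ?lee_fin//.
    exact/lefP/nd_nnsfun_approx.
transitivity (limn (fun n => \int[nu]_y (f n y)%:E)).
  by apply: congr_lim; apply/funext => n; exact: transfer_nnsfun.
rewrite -monotone_convergence//=.
- apply: eq_integral => y _; apply/cvg_lim => //=.
  exact: cvg_nnsfun_approx.
- by move=> n; exact/measurable_EFinP.
- by move=> n y _; rewrite lee_fin.
- by move=> y _ m n mn; rewrite lee_fin; exact/lefP/nd_nnsfun_approx.
Qed.

End Transfer.

(** * The Gamma function *)

Section GammaRecursion.
Context {R : realType}.
Local Notation leb := (@lebesgue_measure R).
Local Open Scope ereal_scope.

Lemma measurable_powR_mul (c p : R) (D : set R) :
  measurable_fun D (fun y : R => (c * y `^ p)%R).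
Proof. by apply: measurable_funTS; apply: measurable_funM. Qed.

(** For [u < 1] the integrand is unbounded near 0, so the interval is exhausted by compact ones, and
    [(x / (i + 2))^u] tends to 0. *)
Lemma integral_powR (x u : R) : (0 < x)%R -> (0 < u)%R ->
  \int[leb]_(y in `]0%R, x]) (u * y `^ (u - 1))%:E = (x `^ u)%:E.
Proof.
move=> x0 u0.
(* Starting at 2 makes every left end strictly smaller than [x], as the fundamental theorem of
   calculus requires. *)
pose D (i : nat) : set R := `[(x / i.+2%:R)%R, x]%classic.
have xi0 i : (0 < x / i.+2%:R)%R by rewrite divr_gt0.
have xix i : (x / i.+2%:R < x)%R.
  by rewrite ltr_pdivrMr// ltr_pMr// ltr1n.
have -> : `]0%R, x]%classic = \bigcup_i D i.
  apply/seteqP; split => [y|y [i _]]; rewrite /D /= !in_itv/=; last first.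
    by move=> /andP[iy ->]; rewrite (lt_le_trans (xi0 i) iy).
  move=> /andP[y0 yx].
  have [n xyn] : exists n, (x / y < n%:R)%R.
    by exists (Num.bound (x / y)%R); apply: archi_boundP; rewrite divr_ge0// ltW.
  exists n => //=; rewrite in_itv/= yx andbT ler_pdivrMr// mulrC -ler_pdivrMr//.
  by rewrite (le_trans (ltW xyn))// ler_nat ltnW.
have dP p (y : R) : (0 < y)%R -> derivable (@powR R ^~ p) y 1.
  by move=> y0; apply: derivable_powR; rewrite in_itv/= y0.
have cP p (y : R) : (0 < y)%R -> {for y, continuous (@powR R ^~ p)}.
  by move=> y0; apply: differentiable_continuous; exact/derivable1_diffP/dP.
have ndD : nondecreasing_seq D.
  apply/nondecreasing_seqP => n; rewrite subsetEset => y.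
  rewrite /D /= !in_itv/= => /andP[+ ->]; rewrite andbT.
  by apply: le_trans; rewrite ler_pM2l// lef_pV2 ?posrE// ler_nat.
have C : \int[leb]_(y in D i) (u * y `^ (u - 1))%:E @[i --> \oo] -->
         \int[leb]_(y in \bigcup_i D i) (u * y `^ (u - 1))%:E.
  apply: ge0_nondecreasing_set_cvg_integral => //.
  - by move=> i; exact: measurable_itv.
  - move=> i; apply/measurable_EFinP; exact: measurable_powR_mul.
  - by move=> i y _; rewrite lee_fin mulr_ge0 ?powR_ge0// ltW.
rewrite -(cvg_lim _ C)//.
apply/cvg_lim => //.
under eq_fun => i.
  rewrite (@continuous_FTC2 _ _ (@powR R ^~ u))//; last 3 first.
  - apply: continuous_in_subspaceT => y; rewrite inE /= in_itv/= => /andP[iy _].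
    have y0 := lt_le_trans (xi0 i) iy.
    apply: cvgM; first exact: cvg_cst.
    exact: cP.
  - split => [y| |].
    + by rewrite in_itv/= => /andP[iy _]; apply: dP; exact: lt_trans iy.
    + by apply: cvg_at_right_filter; exact: cP.
    + by apply: cvg_at_left_filter; exact: cP.
  - move=> y; rewrite in_itv/= => /andP[iy _].
    by rewrite powR_derive1// in_itv/= (lt_trans (xi0 i)).
  rewrite -EFinB.
  over.
apply: cvg_EFin; first exact: nearW.
rewrite -[X in _ --> X]subr0; apply: cvgB; first exact: cvg_cst.
have /cvg_at_rightP := @powR_cvg0 R u u0; apply; split => //.
rewrite -[X in _ --> X](mulr0 x); apply: cvgM; first exact: cvg_cst.
by rewrite (cvg_shiftS (fun n => (n.+1%:R^-1)%R : R)); exact: cvg_harmonic.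
Qed.

Lemma integral_expRN (y : R) :
  \int[leb]_(x in `[y, +oo[) (expR (- x))%:E = (expR (- y))%:E.
Proof.
rewrite (@ge0_continuous_FTC2y _ _ (fun x => - expR (- x))%R _ 0%R).
- by rewrite -EFinB sub0r opprK.
- by move=> x _; exact: expR_ge0.
- apply: continuous_subspaceT => x.
  by apply: continuous_comp; [exact: opp_continuous|exact: continuous_expR].
- rewrite -[X in _ --> X]oppr0; by apply: cvgN; exact: cvgr_expR.
- by move=> x _; exact: ex_derive.
- apply: cvg_at_right_filter; apply: cvgN.
  apply: continuous_comp; last exact: continuous_expR.
  exact: opp_continuous.
- by move=> x _; rewrite derive1E derive_val; rewrite ?scaleN1r ?mulrN1 ?opprK.
Qed.

(* The Euler integral over the open half-line, with values in [\bar R] so that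
   its finiteness need not be known in advance. *)
Definition Gammae (u : R) : \bar R :=
  \int[leb]_(x in `]0%R, +oo[) (expR (- x) * x `^ (u - 1))%:E.

Lemma measurable_Gamma_integrand (u : R) (D : set R) :
  measurable_fun D (fun x : R => (expR (- x) * x `^ (u - 1))%R).
Proof.
by apply: measurable_funTS; apply: measurable_funM => //; exact: measurableT_comp.
Qed.

Lemma GammaE (u : R) : Gamma u = fine (Gammae u).
Proof.
rewrite /Gamma /Rintegral /Gammae integral_itv_obnd_cbnd//.
by apply/measurable_EFinP; exact: measurable_Gamma_integrand.
Qed.

Lemma Gammae_ge0 (u : R) : 0 <= Gammae u.
Proof.
by apply: integral_ge0 => x _; rewrite lee_fin mulr_ge0 ?expR_ge0 ?powR_ge0.
Qed.

(* Tonelli on [e^(-x) u y^(u-1)] over the region [0 < y <= x]. *)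
Lemma GammaeD1 (u : R) : (0 < u)%R -> Gammae (u + 1) = u%:E * Gammae u.
Proof.
move=> u0.
pose f (z : R * R) : R :=
  (if (0 < z.2) && (z.2 <= z.1) then expR (- z.1) * (u * z.2 `^ (u - 1)) else 0)%R.
have f0 z : (0 <= f z)%R.
  by rewrite /f; case: ifP => // _; rewrite !mulr_ge0 ?expR_ge0 ?powR_ge0// ltW.
have mf : measurable_fun [set: R * R] f.
  apply: measurable_fun_ifT => //=.
    apply: measurable_and; first exact: measurable_fun_ltr.
    exact: measurable_fun_ler.
  apply: measurable_funM.
    by apply: measurableT_comp => //; exact: measurableT_comp.
  apply: measurable_funM => //.
  by apply: (measurableT_comp (measurable_powR _)).
have mfE : measurable_fun [set: R * R] (EFin \o f) by exact/measurable_EFinP.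
have f0E z : 0 <= (EFin \o f) z by rewrite lee_fin.
have := @fubini_tonelli _ _ _ _ R leb leb _ mfE f0E => /=.
rewrite /fubini_F /fubini_G/=.
(* Integrating over [y] first produces [x^u] by [integral_powR]; the other order, below, produces
   [e^(-y)] by [integral_expRN]. *)
have -> : \int[leb]_x \int[leb]_y (f (x, y))%:E = Gammae (u + 1).
  rewrite [RHS]integral_mkcond; apply: eq_integral => x _; rewrite patchE.
  case: ifPn => x0; last first.
    rewrite integral0_eq// => y _; rewrite /f/=; case: ifPn => // /andP[y0 yx].
    by move: x0; rewrite notin_setE/= in_itv/= andbT => /negP;
      rewrite (lt_le_trans y0).
  rewrite inE/= in_itv/= andbT in x0.
  rewrite addrK EFinM -integral_powR// -ge0_integralZl; [|by []
    |by apply/measurable_EFinP; exact: measurable_powR_mul|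
    by move=> y _; rewrite lee_fin mulr_ge0 ?powR_ge0// ltW|by rewrite lee_fin expR_ge0].
  rewrite [RHS]integral_mkcond; apply: eq_integral => y _; rewrite patchE /f/=.
  by rewrite mem_setE in_itv/=; case: ifP.
have -> : \int[leb]_y \int[leb]_x (f (x, y))%:E = u%:E * Gammae u.
  rewrite -ge0_integralZl; [|by []
    |by apply/measurable_EFinP; exact: measurable_Gamma_integrand|
    by move=> y _; rewrite lee_fin mulr_ge0 ?expR_ge0 ?powR_ge0|by rewrite lee_fin ltW].
  rewrite [RHS]integral_mkcond; apply: eq_integral => y _; rewrite patchE.
  rewrite mem_setE in_itv/= andbT; case: ifPn => y0; last first.
    by rewrite integral0_eq// => x _; rewrite /f/= (negbTE y0).
  rewrite -EFinM mulrCA EFinM -integral_expRN -ge0_integralZr; [|by []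
    |by apply/measurable_EFinP/measurable_funTS; exact: measurableT_comp|
    by move=> x _; rewrite lee_fin expR_ge0|by rewrite lee_fin mulr_ge0 ?powR_ge0// ltW].
  rewrite [RHS]integral_mkcond; apply: eq_integral => x _; rewrite patchE /f/=.
  by rewrite y0 mem_setE in_itv/= andbT; case: ifP.
by [].
Qed.

Lemma Gammae1 : Gammae 1 = 1.
Proof.
rewrite /Gammae; under eq_integral do rewrite subrr powRr0 mulr1.
rewrite integral_itv_obnd_cbnd ?integral_expRN ?oppr0 ?expR0//.
by apply/measurable_EFinP/measurable_funTS; exact: measurableT_comp.
Qed.

(* [x^u <= 1 + x] bounds [Gamma (u + 1)] and [1 <= x^(u-1) + x^u] bounds
   [Gamma u + Gamma (u + 1)] from below. *)
Lemma Gammae_fin_gt0 (u : R) : (0 < u <= 1)%R ->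
  Gammae u \is a fin_num /\ 0 < Gammae u.
Proof.
move=> /andP[u0 u1].
have ge0 v (x : R) : `]0%R, +oo[%classic x -> 0 <= (expR (- x) * x `^ (v - 1))%:E.
  by move=> _; rewrite lee_fin mulr_ge0 ?expR_ge0 ?powR_ge0.
have mG v : measurable_fun (`]0%R, +oo[%classic : set R)
    (fun x : R => (expR (- x) * x `^ (v - 1))%:E).
  by apply/measurable_EFinP; exact: measurable_Gamma_integrand.
have GD v v' : Gammae v + Gammae v' = \int[leb]_(x in `]0%R, +oo[)
    ((expR (- x) * x `^ (v - 1))%:E + (expR (- x) * x `^ (v' - 1))%:E).
  by rewrite ge0_integralD//; [exact: ge0|exact: mG|exact: ge0|exact: mG].
have up : Gammae (u + 1) <= 1 + 1.
  have <- : Gammae 1 + Gammae (1 + 1) = 1 + 1.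
    by rewrite GammaeD1// mul1e !Gammae1.
  rewrite GD; apply: ge0_le_integral => //.
  - exact: ge0.
  - exact: mG.
  - by apply: emeasurable_funD; exact: mG.
  move=> x; rewrite /= in_itv/= andbT => x0.
  rewrite -EFinD lee_fin -mulrDr ler_pM2l ?expR_gt0// !addrK subrr powRr0.
  rewrite powRr1 ?(ltW x0)//; have [x1|x1] := leP x 1%R.
    rewrite (@le_trans _ _ 1%R) ?lerDl ?(ltW x0)//.
    by rewrite -(powRr0 x) ger_powR ?x0 ?(ltW u0).
  by rewrite (@le_trans _ _ x) ?lerDr// -[leRHS](powRr1 (ltW x0)) ler_powR ?(ltW x1).
have lo : 1 <= (1 + u)%:E * Gammae u.
  rewrite -[leLHS]Gammae1 EFinD ge0_muleDl ?lee_fin ?(ltW u0)// mul1e -GammaeD1//.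
  rewrite GD; apply: ge0_le_integral => //.
  - exact: ge0.
  - exact: mG.
  - by apply: emeasurable_funD; exact: mG.
  move=> x; rewrite /= in_itv/= andbT => x0.
  rewrite -EFinD lee_fin -mulrDr ler_pM2l ?expR_gt0// !addrK subrr powRr0.
  have [x1|x1] := leP x 1%R.
    rewrite (@le_trans _ _ (x `^ (u - 1))%R)// ?lerDl ?powR_ge0//.
    by rewrite -[leLHS](powRr0 x) ger_powR ?x0// subr_le0.
  rewrite (@le_trans _ _ (x `^ u)%R)// ?lerDr ?powR_ge0//.
  by rewrite -[leLHS](powRr0 x) ler_powR ?(ltW x1) ?(ltW u0).
(* Through [Gamma (u + 1) = u Gamma u], the bound [lo] excludes the value 0 and the bound [up]
   excludes [+oo]. *)
have Gu0 : 0 < Gammae u.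
  rewrite lt_neqAle Gammae_ge0 andbT eq_sym; apply/eqP => G0.
  by move: lo; rewrite G0 mule0 lee_fin ler10.
split=> //; rewrite ge0_fin_numE ?ltW//.
rewrite ltey; apply/eqP => Goo.
by move: up; rewrite GammaeD1// Goo gt0_muley ?lte_fin// leye_eq.
Qed.

Lemma Gamma_gt0 (u : R) : (0 < u <= 1)%R -> (0 < Gamma u)%R.
Proof.
by move=> /Gammae_fin_gt0[fG G0]; rewrite GammaE fine_gt0// G0 -ge0_fin_numE ?ltW.
Qed.

Lemma Gammae_rising (u : R) n : (0 < u <= 1)%R ->
  Gammae (u + n%:R) = (rising u n * Gamma u)%:E.
Proof.
move=> u01; have [fG _] := Gammae_fin_gt0 u01; have /andP[u0 _] := u01.
elim: n => [|n IH].
  by rewrite /rising big_ord0 addr0 mul1r GammaE fineK.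
rewrite -natr1 addrA GammaeD1 ?ltr_wpDr// IH -EFinM /rising big_ord_recr/=.
by congr (_%:E); ring.
Qed.

(** The factor [x^n] turns the integrand of [Gamma u] into that of [Gamma (u + n)]. The absolute
    value keeps the integrand nonnegative on the whole line, where the density vanishes for
    [x < 0]. *)
Lemma integral_gamma_pdf_moment (u : R) n : (0 < u < 1)%R ->
  \int[leb]_x (gamma_pdf u x * `|x| ^+ n)%:E = (rising u n)%:E.
Proof.
move=> /andP[u0 u1]; have u01 : (0 < u <= 1)%R by rewrite u0 ltW.
have Gu := Gamma_gt0 u01.
transitivity (\int[leb]_(x in `]0%R, +oo[)
    ((Gamma u)^-1%:E * (expR (- x) * x `^ (u + n%:R - 1))%:E)).
  rewrite integral_itv_obnd_cbnd; last first.
    apply: measurable_funeM; apply/measurable_EFinP.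
    exact: measurable_Gamma_integrand.
  rewrite [RHS]integral_mkcond; apply: eq_integral => x _; rewrite patchE.
  rewrite mem_setE in_itv/= andbT /gamma_pdf.
  case: ifPn => x0; last by rewrite mul0r.
  rewrite -EFinM ger0_norm//; congr (_%:E).
  have -> : (x `^ (u + n%:R - 1) = x `^ (u - 1) * x ^+ n)%R.
    (* At [x = 0] the exponent law is checked separately: a real power of 0 is 0 unless the exponent
       is 0, and [u < 1] keeps [u - 1] nonzero. *)
    rewrite -powR_mulrn// addrAC; case: (eqVneq x 0%R) => [->|xn0]; last first.
      by apply: powRD; rewrite xn0 implybT.
    have un0 : (u - 1 != 0)%R by rewrite subr_eq0 lt_eqF.
    rewrite (powR0 un0) mul0r powR0//; case: n => [|n]; first by rewrite addr0.
    rewrite (_ : u - 1 + n.+1%:R = u + n%:R)%R; last by rewrite -natr1; ring.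
    by rewrite gt_eqF// ltr_wpDr.
  by ring.
rewrite ge0_integralZl; [|by []
    |by apply/measurable_EFinP; exact: measurable_Gamma_integrand|
  by move=> x _; rewrite lee_fin mulr_ge0 ?expR_ge0 ?powR_ge0|by rewrite lee_fin invr_ge0 ltW].
by rewrite -/(Gammae _) Gammae_rising// -EFinM mulrC mulfK// gt_eqF.
Qed.

End GammaRecursion.

(** * Moments of the mixed gamma law *)

Section MixedGammaMoment.
Context {R : realType}.
Local Notation leb := (@lebesgue_measure R).
Local Open Scope ereal_scope.

Lemma Gamma_ge0 (u : R) : (0 <= Gamma u)%R.
Proof. by rewrite GammaE fine_ge0// Gammae_ge0. Qed.

Lemma gamma_pdf_ge0 (u x : R) : (0 <= gamma_pdf u x)%R.
Proof.
rewrite /gamma_pdf; case: ifP => // _.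
by rewrite divr_ge0 ?Gamma_ge0// mulr_ge0 ?expR_ge0 ?powR_ge0.
Qed.

Lemma measurable_powR_pair : measurable_fun [set: R * R]
  (fun z : R * R => (expR (- z.2) * z.2 `^ (z.1 - 1))%R).
Proof.
apply: measurable_funM; first by do 2 apply: measurableT_comp => //.
have m1 : measurable_fun [set: R * R] (fun z : R * R => (z.1 - 1)%R).
  exact: measurable_funB.
rewrite /powR; apply: measurable_fun_ifT => //=.
- exact: measurable_fun_eqr.
- apply: (measurableT_comp (f := fun b : bool => b%:R%R : R)) => //.
  exact: measurable_fun_eqr.
- apply: measurableT_comp => //; apply: measurable_funM => //.
  by apply: measurableT_comp => //; exact: measurable_ln.
Qed.

(** [Gammae] is a partial integral of a jointly measurable nonnegative function, so Tonelli covers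
    every real [u], even where the integral is infinite. *)
Lemma measurable_Gamma : measurable_fun [set: R] (@Gamma R).
Proof.
have -> : @Gamma R = fine \o @Gammae R by apply/funext => u; exact: GammaE.
apply: measurableT_comp; first exact: fine_measurable.
pose f (z : R * R) : \bar R :=
  (if (0 < z.2)%R then expR (- z.2) * z.2 `^ (z.1 - 1) else 0)%R%:E.
have mf : measurable_fun [set: R * R] f.
  apply/measurable_EFinP/measurable_fun_ifT => //=; first exact: measurable_fun_ltr.
  exact: measurable_powR_pair.
have f0 z : 0 <= f z.
  by rewrite lee_fin; case: ifP => // _; rewrite mulr_ge0 ?expR_ge0 ?powR_ge0.
have -> : @Gammae R = (fun u => \int[leb]_x f (u, x)).
  apply/funext => u; rewrite /Gammae integral_mkcond; apply: eq_integral => x _.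
  by rewrite patchE mem_setE in_itv/= andbT /f/=; case: ifP.
exact: (@measurable_fun_fubini_tonelli_F _ _ _ _ R leb f mf f0).
Qed.

Lemma measurable_gamma_pdf :
  measurable_fun [set: R * R] (fun z : R * R => gamma_pdf z.1 z.2).
Proof.
apply: measurable_fun_ifT => //=; first exact: measurable_fun_ler.
apply: measurable_funM; first exact: measurable_powR_pair.
(* The inverse becomes a real power with exponent -1, to which the measurability of [powR]
   applies. *)
under eq_fun do rewrite -powR_inv1 ?Gamma_ge0//.
apply: (measurableT_comp (measurable_powR _)).
by apply: measurableT_comp => //; exact: measurable_Gamma.
Qed.

Context (d : measure_display) (T : measurableType d) (P : probability T R).
Context (U X : {RV P >-> R}).
Context (hU : forall A : set R, measurable A ->
  distribution P U A = uniform_prob (@ltr01 R) A).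
Context (hX : has_conditional_density P U X gamma_pdf).

(** By [hX] with the whole line for [U], the law of [X] is the image under the second projection of
    the law of [U] times Lebesgue measure, weighted by [gamma_pdf]. Tonelli separates the two
    integrals. *)
Lemma mixed_gamma_ge0_integral (g : R -> \bar R) :
  measurable_fun [set: R] g -> (forall x, 0 <= g x) ->
  \int[distribution P X]_x g x =
  \int[leb]_(u in `]0%R, 1%R[) \int[leb]_x ((gamma_pdf u x)%:E * g x).
Proof.
move=> mg g0.
have mw : measurable_fun [set: R * R] (EFin \o (fun z : R * R => gamma_pdf z.1 z.2)).
  by apply/measurable_EFinP; exact: measurable_gamma_pdf.
rewrite -(@ge0_integral_density _ _ _ _ _ (distribution P U \x leb)
  (distribution P X) (fun z : R * R => gamma_pdf z.1 z.2) snd) //; first last.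
- move=> B mB.
  have mBw : measurable_fun [set: R * R]
      ((EFin \o (fun z : R * R => gamma_pdf z.1 z.2)) \_ (snd @^-1` B)).
    apply/(measurable_restrictT _ _).1; last exact: measurable_funTS.
    by rewrite -[_ @^-1` _]setTI; exact: measurable_snd.
  have Bw0 z : 0 <=
      ((EFin \o (fun z : R * R => gamma_pdf z.1 z.2)) \_ (snd @^-1` B)) z.
    by apply: erestrict_ge0 => t _; rewrite lee_fin gamma_pdf_ge0.
  rewrite integral_mkcond.
  apply: etrans (@fubini_tonelli1 _ _ _ _ _ (distribution P U) leb _ mBw Bw0) _.
  rewrite /fubini_F.
  transitivity (P (U @^-1` setT `&` X @^-1` B)); last by rewrite preimage_setT setTI.
  rewrite (hX measurableT mB); apply: eq_integral => u _.
  rewrite [RHS]integral_mkcond; apply: eq_integral => x _.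
  by rewrite !patchE; congr (if _ then _ else _); apply/idP/idP; rewrite !inE.
- by move=> z; exact: gamma_pdf_ge0.
- exact: measurable_gamma_pdf.
have mwg : measurable_fun [set: R * R]
    (fun z : R * R => (gamma_pdf z.1 z.2)%:E * g z.2).
  by apply: emeasurable_funM => //; exact: measurableT_comp.
have wg0 z : 0 <= (gamma_pdf z.1 z.2)%:E * g z.2.
  by rewrite mule_ge0 ?lee_fin ?gamma_pdf_ge0.
apply: etrans (@fubini_tonelli1 _ _ _ _ _ (distribution P U) leb _ mwg wg0) _.
have mF := measurable_fun_fubini_tonelli_F (m2 := leb) _ mwg wg0.
rewrite /fubini_F/= in mF *.
transitivity (\int[uniform_prob (@ltr01 R)]_u \int[leb]_x ((gamma_pdf u x)%:E * g x)).
  (* [measurableTypeR R] and [R] carry different displays; the identity between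
     them is measurable. *)
  rewrite -(@ge0_integral_density _ _ (measurableTypeR R) R R
    (uniform_prob (@ltr01 R)) (distribution P U) (cst 1%R) idfun)//; last 3 first.
  - by move=> _ B mB; rewrite setTI.
  - move=> B mB; apply: etrans (esym (hU mB)); rewrite -[RHS]mul1e.
    exact: (@integral_cst _ (measurableTypeR R) _ (uniform_prob (@ltr01 R)) B mB 1).
  - by move=> u; apply: integral_ge0 => x _; exact: (wg0 (u, x)).
  by apply: eq_integral => u _; rewrite mul1e.
rewrite integral_uniform//; last first.
  by move=> u; apply: integral_ge0 => x _; exact: (wg0 (u, x)).
(* Both endpoints are dropped, since the gamma moments are computed for [0 < u < 1]. *)
rewrite subr0 invr1 mul1e -integral_itv_obnd_cbnd; last first.
  exact: measurable_funTS.
rewrite integral_itv_bndo_bndc//.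
exact: measurable_funTS.
Qed.

Lemma mixed_gamma_moment n :
  \int[distribution P X]_x (`|x| ^+ n)%:E = (unit_mean (fun u => rising u n))%:E.
Proof.
have mn : measurable_fun [set: R] (fun x : R => (`|x| ^+ n)%:E).
  by apply/measurable_EFinP; exact: (measurable_funX n (@normr_measurable R setT)).
rewrite mixed_gamma_ge0_integral//.
have mr (D : set R) : measurable_fun D (fun u : R => (rising u n)%:E).
  apply/measurable_EFinP; apply: measurable_funTS.
  exact: (continuous_measurable_fun (@continuous_rising R n)).
rewrite /unit_mean /Rintegral fineK; last first.
  exact/integrable_fin_num/unit_mean_integrable/continuous_rising.
rewrite -integral_itv_obnd_cbnd// -integral_itv_bndo_bndc//.
apply: eq_integral => u; rewrite inE/= in_itv/= => u01.
by rewrite -integral_gamma_pdf_moment.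
Qed.

(** This allows [|X|], used in all moment computations, to be replaced by [X] almost everywhere. *)
Lemma mixed_gamma_lt0 : distribution P X `]-oo, 0%R[ = 0.
Proof.
have := hX measurableT (measurable_itv `]-oo, 0%R[).
rewrite preimage_setT setTI => e; apply: etrans e _.
apply: integral0_eq => u _; apply: integral0_eq => x.
by rewrite /= in_itv/= /gamma_pdf => x0; rewrite leNgt x0.
Qed.

End MixedGammaMoment.

(** * Moments of sums of independent variables *)

Section IndependentMoments.
Context {R : realType} {d : measure_display} {T : measurableType d}.
Context (P : probability T R) (I : finType) (X : I -> {RV P >-> R}).
Context (nu : probability R R) (m : fps R).
Context (indX : independent_RVs P X).
Context (lawX : forall i (A : set R), measurable A ->
  distribution P (X i) A = nu A).
Context (momX : forall n,
  (\int[nu]_x (`|x| ^+ n)%:E = (n`!%:R * m n)%:E)%E).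

(** Events are imposed only outside [J]; the variables indexed by [J] are the ones to be
    integrated. *)
Let cyl (J : {set I}) (A : I -> set R) : set T :=
  \bigcap_(i in [set` ~: J]%SET) (X i @^-1` A i).

Let S (J : {set I}) (w : T) : R := \sum_(i in J) `|X i w|.

Let S_ge0 J w : 0 <= S J w. Proof. exact: sumr_ge0. Qed.

Let mS J : measurable_fun [set: T] (S J).
Proof.
rewrite /S; under eq_fun do rewrite big_mkcond/=.
apply: measurable_sum => i; case: (i \in J); last by [].
by apply: measurableT_comp; [exact: normr_measurable|exact: measurable_funPT].
Qed.

Let mXV i (A : set R) : measurable A -> measurable (X i @^-1` A).
Proof. by move=> mA; rewrite -[_ @^-1` _]setTI; exact: measurable_funPT. Qed.

Let mcyl J A : (forall i, measurable (A i)) -> measurable (cyl J A).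
Proof.
move=> mA; apply: fin_bigcap_measurable => //.
by move=> i _; exact: mXV.
Qed.

Let m_ge0 n : 0 <= m n.
Proof.
rewrite -(pmulr_rge0 _ (_ : 0 < n`!%:R)) ?ltr0n ?fact_gt0//.
by rewrite -lee_fin -momX integral_ge0// => x _; rewrite lee_fin exprn_ge0.
Qed.

Let mX_ge0 k n : 0 <= (m ^+ k) n.
Proof.
elim: k n => [|k IH] n; first by rewrite expr0 fps1 ler0n.
by rewrite exprS fpsM sumr_ge0// => i _; rewrite mulr_ge0.
Qed.

Let P_cyl J A : (forall i, measurable (A i)) ->
  P (cyl J A) = (\prod_(i in ~: J) fine (nu (A i)))%:E.
Proof.
move=> mA; rewrite /cyl indX// (big_morph EFin (@EFinM R) erefl).
apply: eq_bigr => i _; rewrite fineK ?fin_num_measure//.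
exact: lawX.
Qed.

Let cylD1 (J : {set I}) j A (B : set R) : j \in J ->
  cyl (J :\ j) (fun i => if i == j then B else A i) = cyl J A `&` X j @^-1` B.
Proof.
move=> jJ; apply/seteqP; split => [z Cz|z [Cz Bz] i /=].
  split=> [i /= |].
    rewrite inE => iJ; have ij : i != j by apply: contraNneq iJ => ->.
    have := Cz i; rewrite (negbTE ij); apply => /=.
    by rewrite !inE negb_and iJ orbT.
  by have := Cz j; rewrite eqxx; apply; rewrite /= !inE eqxx.
rewrite !inE negb_and negbK => iJ; case: eqVneq iJ => [->//|ij /= iJ].
by apply: Cz; rewrite /= inE.
Qed.

(** Induction on the size of [J], with [A] arbitrary: splitting off [j] from [J], the induction
    hypothesis with an event imposed on [X j] factors the mixed moments, and the binomial theorem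
    reassembles the power of the sum. *)
Lemma cyl_moment (J : {set I}) n (A : I -> set R) :
  (forall i, measurable (A i)) ->
  (\int[P]_(w in cyl J A) ((S J w) ^+ n)%:E =
   (n`!%:R * (m ^+ #|J|) n * \prod_(i in ~: J) fine (nu (A i)))%:E)%E.
Proof.
elim: {J}#|J| {-2}J (erefl #|J|) n A => [|c IH] J cJ n A mA.
  have J0 : J = finset.set0 by apply/eqP; rewrite -cards_eq0 cJ.
  rewrite cJ expr0 fps1.
  transitivity (\int[P]_(w in cyl J A) cst ((n == 0)%N%:R%:E) w)%E.
    by apply: eq_integral => w _; rewrite /S J0 big_set0 expr0n.
  rewrite integral_cst; last exact: mcyl.
  rewrite [X in (_ * X)%E](P_cyl J mA) -EFinM; congr (_%:E).
  case: (n) => [|n']; last by rewrite mulr0 !mul0r.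
  by rewrite mulr1 mul1r.
have [j jJ] : exists j, j \in J by apply/card_gt0P; rewrite cJ.
pose J' := J :\ j.
have cJ' : #|J'| = c by apply/eqP; rewrite -eqSS -cJ (cardsD1 j J) jJ.
have SJ w : S J w = S J' w + `|X j w| by rewrite /S (big_setD1 j)//= addrC.
pose p := \prod_(i in ~: J) fine (nu (A i)).
have p0 : 0 <= p by apply: prodr_ge0 => i _; rewrite fine_ge0.
have term a b : (\int[P]_(w in cyl J A) (S J' w ^+ a * `|X j w| ^+ b)%:E =
    (a`!%:R * (m ^+ c) a * p * (b`!%:R * m b))%:E)%E.
  have c0 : 0 <= a`!%:R * (m ^+ c) a * p by rewrite !mulr_ge0.
  pose w z := S J' z ^+ a * \1_(cyl J A) z.
  have mw : measurable_fun [set: T] w.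
    apply: measurable_funM; first exact: measurable_funX.
    by apply: measurable_indic; exact: mcyl.
  have w0 z : 0 <= w z by rewrite mulr_ge0 ?exprn_ge0.
  have mg : measurable_fun [set: R] (fun x : R => (`|x| ^+ b)%:E).
    by apply/measurable_EFinP; exact: (measurable_funX b (@normr_measurable R setT)).
  have g0 (x : R) : (0 <= (`|x| ^+ b)%:E)%E by rewrite lee_fin exprn_ge0.
  transitivity (\int[P]_z ((w z)%:E * (`|X j z| ^+ b)%:E))%E.
    rewrite integral_mkcond; apply: eq_integral => z _; rewrite patchE /w indicE.
    by case: ifP => _; rewrite ?mulr1 ?mulr0 ?mul0e// EFinM.
  (* The image under [X j] of [P] weighted by [w] is a multiple of [nu]: its value on [B] is the
     induction hypothesis for [J'] with [X j] constrained to [B]. *)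
  transitivity (\int[mscale (NngNum c0) nu]_x (`|x| ^+ b)%:E)%E.
    refine (@ge0_integral_density _ _ _ _ _ P _ w (X j) mw w0
      (measurable_funPT (X j)) _ (fun x => (`|x| ^+ b)%:E) mg g0).
    move=> B mB; pose A' i := if i == j then B else A i.
    have mA' i : measurable (A' i) by rewrite /A'; case: ifP.
    transitivity (\int[P]_(z in cyl J' A') (S J' z ^+ a)%:E)%E.
      rewrite cylD1// [LHS]integral_mkcond [RHS]integral_mkcond.
      apply: eq_integral => z _; rewrite !patchE /w indicE in_setI.
      by case: (z \in X j @^-1` B); rewrite ?andbF// andbT;
        case: ifP; rewrite ?mulr1 ?mulr0.
    rewrite (IH J' cJ' a A' mA') cJ' /mscale/=.
    have -> : ~: J' = j |: ~: J by rewrite /J' finset.setCD finset.setUC.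
    rewrite big_setU1/= ?inE ?jJ// {1}/A' eqxx.
    (* Since [j] lies in [J], the families [A'] and [A] agree outside [J]. *)
    have -> : \prod_(i in ~: J) fine (nu (A' i)) = p.
      apply: eq_bigr => i; rewrite inE /A' => iJ; case: eqVneq iJ => [->|//].
      by rewrite jJ.
    by rewrite mulrCA mulrC EFinM fineK ?fin_num_measure.
  rewrite ge0_integral_mscale//= momX -EFinM//.
have term_ge0 a b w : 0 <= S J' w ^+ a * `|X j w| ^+ b.
  by rewrite mulr_ge0 ?exprn_ge0.
have mterm1 a b : measurable_fun [set: T]
    (fun w => (S J' w ^+ a * `|X j w| ^+ b)%:E).
  apply/measurable_EFinP; apply: measurable_funM; first exact: measurable_funX.
  apply: measurable_funX; apply: measurableT_comp; first exact: normr_measurable.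
  exact: measurable_funPT.
have mterm (i a b : nat) : measurable_fun [set: T]
    (fun w => (i%:R * (S J' w ^+ a * `|X j w| ^+ b))%:E).
  by under eq_fun do rewrite EFinM; exact: measurable_funeM.
transitivity (\sum_(i < n.+1) \int[P]_(w in cyl J A)
    ('C(n, i)%:R * (S J' w ^+ (n - i) * `|X j w| ^+ i))%:E)%E.
  rewrite -ge0_integral_sum//; last 3 first.
  - exact: mcyl.
  - by move=> i; apply: measurable_funTS; exact: mterm.
  - by move=> i w _; rewrite lee_fin mulr_ge0 ?ler0n// term_ge0.
  apply: eq_integral => w _; rewrite sumEFin SJ exprDn; congr (_%:E).
  by apply: eq_bigr => i _; rewrite mulr_natl.
transitivity (\sum_(i < n.+1)
    ('C(n, i)%:R * ((n - i)`!%:R * (m ^+ c) (n - i)%N * p * (i`!%:R * m i)))%:E)%E.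
  apply: eq_bigr => i _; rewrite [in RHS]EFinM -term -ge0_integralZl//.
  - exact: mcyl.
  - by apply: measurable_funTS; exact: mterm1.
  - by move=> w _; rewrite lee_fin term_ge0.
rewrite sumEFin; congr (_%:E).
(* The factorials in ['C(n, i) i! (n - i)! = n!] turn the binomial sum into the Cauchy product
   [m * m ^+ c]. *)
rewrite cJ exprS fpsM mulr_sumr mulr_suml; apply: eq_bigr => i _.
have ni : (i <= n)%N by rewrite -ltnS.
rewrite -(bin_fact ni) !natrM -/p; ring.
Qed.

End IndependentMoments.

(** * Moments of sums of independent mixed gamma variables *)

Theorem theorem6 (R : realType)
  (* X' plays the role of the generic X, with its mixing variable U *)
  (d' : measure_display) (T' : measurableType d') (P' : probability T' R)
  (U X' : {RV P' >-> R})
  (hU : forall A : set R, measurable A ->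
    distribution P' U A = uniform_prob (@ltr01 R) A)
  (hX' : has_conditional_density P' U X' gamma_pdf)
  (d : measure_display) (T : measurableType d) (P : probability T R)
  (k : nat) (hk : (1 <= k)%N) (X : 'I_k -> {RV P >-> R})
  (hindep : independent_RVs P X)
  (hX : forall (i : 'I_k) (A : set R), measurable A ->
    distribution P (X i) A = distribution P' X' A)
  (n : nat) :
  'E_P[fun w => ((\sum_(i < k) X i w) ^+ n)%R]%E =
    ((-1) ^+ n * bernoulli_poly (n%:Z - k%:Z + 1) n (- k%:R + 1 : R))%:E.
Proof.
have momX' j : (\int[distribution P' X']_x (`|x| ^+ j)%:E =
    (j`!%:R * rising_moment j)%:E)%E.
  rewrite (mixed_gamma_moment hU hX'); congr (_%:E).
  rewrite -unit_meanZ; last first.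
    by move=> u; apply: cvgM; [exact: continuous_rising|exact: cvg_cst].
  congr unit_mean; apply/funext => u; rewrite /fps_rising mulrCA divff ?mulr1//.
have X_ge0 : {ae P, forall w, forall i, 0 <= X i w}.
  apply: filter_forall => i.
  exists (X i @^-1` `]-oo, 0[%classic); split.
  - by rewrite -[_ @^-1` _]setTI; exact: measurable_funPT.
  - have := hX i _ (measurable_itv `]-oo, (0 : R)[).
    by rewrite (mixed_gamma_lt0 hX').
  - by move=> w /=; rewrite in_itv/= => /negP; rewrite -ltNge.
rewrite unlock -rising_moment_bernoulli.
(* With [J] the full index set no event is imposed, so the cylinder is the whole space and the
   product over its complement is 1. *)
have := cyl_moment hindep hX momX' [set: 'I_k]%SET n (fun _ => measurableT).
rewrite finset.setCT big_set0 mulr1 cardsT card_ord => <-.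
have -> : \bigcap_(i in [set` finset.set0]) (X i @^-1` setT) = setT.
  by apply/seteqP; split => // w _ i.
have mX i : measurable_fun setT (X i) by exact: measurable_funPT.
have sumT w : \sum_(i in [set: 'I_k]%SET) `|X i w| = \sum_(i < k) `|X i w|.
  by apply: eq_bigl => i; rewrite inE.
under [RHS]eq_integral do rewrite sumT.
(* The integrands with and without absolute values agree wherever all the [X i] are nonnegative,
   hence almost everywhere. *)
apply: ae_eq_integral => //.
- by apply/measurable_EFinP; apply: measurable_funX; exact: measurable_sum.
- apply/measurable_EFinP; apply: measurable_funX; apply: measurable_sum => i.
  by apply: measurableT_comp; first exact: normr_measurable.
apply: filterS X_ge0 => w Xw _; congr ((_ ^+ _)%:E).
by apply: eq_bigr => i _; rewrite ger0_norm.
Qed.
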